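(* Let $n\ge2$, $G=Sp(\mathbb R^{2n})$, $K\cong U(n)$ its maximal compact subgroup, and let $\Lambda=(\Lambda_1,\dots,\Lambda_n)\in\mathcal C_{\mathrm{hol}}$. Then $$\Delta_K(G\cdot\Lambda)=\bigl(\Lambda+\mathrm{Cone}_{\mathbb R}(\mathfrak R_n^+)\bigr)\cap\mathfrak t_+^*=\{(\xi_1,\dots,\xi_n)\in\mathfrak t_+^*:\ \xi_i\ge\Lambda_i\text{ for all }i=1,\dots,n\}.$$
   Context: $T$ is the torus of diagonal matrices of $U(n)$, $\mathfrak t$ its Lie algebra, and $(e_1^*,\dots,e_n^* )$ is the basis of $\mathfrak t^*$ with $e_j^*(i\,\mathrm{diag}(h_1,\dots,h_n))=h_j$; coordinates on $\mathfrak t^*$ are with respect to this basis. Roots $\alpha\in\mathfrak t^*$ are defined by $[H,X]=i\alpha(H)X$, $H\in\mathfrak t$. The positive compact roots are $e_i^*-e_j^*$, $1\le i<j\le n$, with Weyl chamber $\mathfrak t_+^*=\{\xi_1\ge\dots\ge\xi_n\}$. The positive noncompact roots (for the chosen invariant complex structure on $G/K$) are $\mathfrak R_n^+=\{e_i^*+e_j^*:1\le i\le j\le n\}$. The holomorphic chamber is $\mathcal C_{\mathrm{hol}}=\{\xi\in\mathfrak t_+^*:(\beta,\xi)>0\ \forall\beta\in\mathfrak R_n^+\}$, $(\cdot,\cdot)$ being the inner product induced (up to sign) by the Killing form of $\mathfrak g$. $\mathrm{Cone}_{\mathbb R}(S)$ is the convex cone of nonnegative real combinations of elements of $S$. As usual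 $\mathfrak t^*\subset\mathfrak k^*\subset\mathfrak g^*$ via the Killing form. $G\cdot\Lambda$ is the coadjoint orbit, $\Phi_K:G\cdot\Lambda\to\mathfrak k^*$ is the restriction of the projection $\mathfrak g^*\to\mathfrak k^*$, and $\Delta_K(G\cdot\Lambda)=\Phi_K(G\cdot\Lambda)\cap\mathfrak t_+^*$. *)

(* Defs.v *)
From HB Require Import structures.
From mathcomp Require Import all_boot all_order all_algebra.
From mathcomp Require Import complex.
From mathcomp Require Import boolp classical_sets reals.

Set Implicit Arguments.
Unset Strict Implicit.
Unset Printing Implicit Defensive.

Import Order.TTheory GRing.Theory Num.Theory.
Local Open Scope classical_set_scope.
Local Open Scope complex_scope.
Local Open Scope ring_scope.

Lemma linfun_linear (K : fieldType) (U V : vectType K) (f : U -> V) (u : U) :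
  linear f -> linfun f u = f u.
Proof.
move=> lin_f.
pose m := GRing.isLinear.Build K U V *:%R f lin_f.
pose F : {linear U -> V} := HB.pack f m.
exact: (lfunE F u).
Qed.

Definition sympJ (R : realType) (n : nat) : 'M[R]_(n + n) :=
  block_mx 0 (- 1%:M) 1%:M 0.

Definition Sp (R : realType) (n : nat) : set 'M[R]_(n + n) :=
  [set g | g^T *m sympJ R n *m g = sympJ R n].

Definition sp (R : realType) (n : nat) : {vspace 'M[R]_(n + n)} :=
  lker (linfun (fun X : 'M[R]_(n + n) => X^T *m sympJ R n + sympJ R n *m X)).

Definition lie (R : realType) (m : nat) (X Y : 'M[R]_m) : 'M[R]_m :=
  X *m Y - Y *m X.

(** The trace of [ad X \o ad Y] on [sp R n], computed in a basis. *)
Definition killing (R : realType) (n : nat) (X Y : 'M[R]_(n + n)) : R :=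
  \sum_(i < \dim (sp R n))
    coord (vbasis (sp R n)) i (lie X (lie Y (vbasis (sp R n))`_i)).

(** [A + iB |-> [A, -B; B, A]], which identifies [U(n)] with
    [Sp R n] intersected with the orthogonal group. *)
Definition realify (R : realType) (n : nat) (Z : 'M[R[i]]_n) :
    'M[R]_(n + n) :=
  block_mx (map_mx (@complex.Re R) Z) (- map_mx (@complex.Im R) Z)
           (map_mx (@complex.Im R) Z) (map_mx (@complex.Re R) Z).

(** The skew-symmetric elements of [sp R n], i.e. the Lie algebra of the
    maximal compact subgroup [K], the intersection of [Sp R n] with the
    orthogonal group; see [kalgP] for its identification with [u(n)]. *)
Definition kalg (R : realType) (n : nat) : {vspace 'M[R]_(n + n)} :=
  (sp R n :&: lker (linfun (fun X : 'M[R]_(n + n) => X^T + X)%R))%VS.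

(** The image in [kalg R n] of [i diag(h_1, ..., h_n)]. *)
Definition torus (R : realType) (n : nat) (h : 'rV[R]_n) : 'M[R]_(n + n) :=
  realify (diag_mx (map_mx (fun x : R => 0 +i* x) h)).

Definition talg (R : realType) (n : nat) : {vspace 'M[R]_(n + n)} :=
  limg (linfun (@torus R n)).

Definition ldual (R : realType) (m : nat) (V : {vspace 'M[R]_m}) :=
  'Hom(subvs_of V, R^o).

(** Meant for [V] included in [W], where [vsproj W] is the inclusion. *)
Definition restrict (R : realType) (m : nat) (V W : {vspace 'M[R]_m})
    (l : ldual W) : ldual V :=
  linfun (fun X : subvs_of V => l (vsproj W (vsval X))).

(** The element of [V] representing the linear form [l] through the Killing
    form; it exists and is unique when the Killing form is nondegenerate on
    [V], as is the case for [talg], [kalg] and [sp]. *)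
Definition sharp (R : realType) (n : nat) (V : {vspace 'M[R]_(n + n)})
    (l : ldual V) : 'M[R]_(n + n) :=
  vsval (xget 0 [set H : subvs_of V |
    forall X : subvs_of V, killing (vsval H) (vsval X) = l X]).

(** The inclusion of the dual of [V] into the dual of a larger [W] given by
    the Killing form. *)
Definition extend (R : realType) (n : nat) (V W : {vspace 'M[R]_(n + n)})
    (l : ldual V) : ldual W :=
  linfun (fun X : subvs_of W => killing (sharp l) (vsval X) : R^o).

Definition coad (R : realType) (n : nat) (g : 'M[R]_(n + n))
    (l : ldual (sp R n)) : ldual (sp R n) :=
  linfun (fun X : subvs_of (sp R n) =>
    l (vsproj (sp R n) (invmx g *m vsval X *m g))).

Definition coadjoint_orbit (R : realType) (n : nat) (l : ldual (sp R n)) :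
    set (ldual (sp R n)) :=
  [set coad g l | g in @Sp R n].

(** The linear form [i diag(h_1, ..., h_n) |-> h_j]; see [estarE]. *)
Definition estar (R : realType) (n : nat) (j : 'I_n) : ldual (talg R n) :=
  linfun (fun X : subvs_of (talg R n) => dlsubmx (vsval X) j j : R^o).

Definition tform (R : realType) (n : nat) (xi : 'rV[R]_n) : ldual (talg R n) :=
  \sum_j xi 0 j *: estar R j.

(** The Killing form is negative definite on [talg R n], whence the sign. *)
Definition tdot (R : realType) (n : nat) (xi eta : 'rV[R]_n) : R :=
  - killing (sharp (tform xi)) (sharp (tform eta)).

(** As in [tdot], elements of the dual of [talg R n] are given below by
    their coordinates in the basis [estar]. *)

Definition weyl_chamber (R : realType) (n : nat) : set 'rV[R]_n :=
  [set xi | forall i j : 'I_n, (i <= j)%N -> xi 0 j <= xi 0 i].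

Definition noncompact_roots (R : realType) (n : nat) : set 'rV[R]_n :=
  [set beta | exists i j : 'I_n,
    (i <= j)%N /\ beta = delta_mx 0 i + delta_mx 0 j].

Definition hol_chamber (R : realType) (n : nat) : set 'rV[R]_n :=
  [set xi | weyl_chamber xi /\
    forall beta, noncompact_roots beta -> 0 < tdot beta xi].

Definition cone (R : realType) (V : lmodType R) (S : set V) : set V :=
  [set v | exists (m : nat) (c : 'I_m -> R) (s : 'I_m -> V),
    [/\ forall i, 0 <= c i, forall i, S (s i) & v = \sum_i c i *: s i]].

Definition PhiK (R : realType) (n : nat) (l : ldual (sp R n)) : ldual (kalg R n) :=
  restrict (kalg R n) l.

Definition DeltaK (R : realType) (n : nat) (O : set (ldual (sp R n))) :
    set 'rV[R]_n :=
  [set xi | (@PhiK R n @` O) (extend (kalg R n) (tform xi))] `&`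
  @weyl_chamber R n.

Lemma mem_sp (R : realType) (n : nat) (X : 'M[R]_(n + n)) :
  (X \in sp R n) = (X^T *m sympJ R n + sympJ R n *m X == 0).
Proof.
rewrite memv_ker linfun_linear // => a A B.
rewrite linearP /= mulmxDl mulmxDr -scalemxAl -scalemxAr scalerDr.
by rewrite addrACA.
Qed.

Lemma mem_kalg (R : realType) (n : nat) (X : 'M[R]_(n + n)) :
  (X \in kalg R n) = (X \in sp R n) && (X^T + X == 0).
Proof.
rewrite memv_cap memv_ker linfun_linear // => a A B.
by rewrite linearP /= scalerDr addrACA.
Qed.

Lemma kalgP (R : realType) (n : nat) (X : 'M[R]_(n + n)) :
  X \in kalg R n <->
  exists2 Z : 'M[R[i]]_n, (map_mx (@conjc R) Z)^T = - Z & X = realify Z.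
Proof.
rewrite mem_kalg mem_sp /sympJ; split=> [/andP[]|[Z ZH ->{X}]].
  rewrite -{1 2 3 4}(submxK X); move: (ulsubmx X) (ursubmx X) (dlsubmx X)
    (drsubmx X) (submxK X) => A B C D <-{X}.
  rewrite !tr_block_mx !mulmx_block !add_block_mx.
  rewrite !(mul0mx, mulmx0, mulNmx, mulmxN, mul1mx, mulmx1, addr0, add0r).
  rewrite -{1}(@block_mx0 R n n n n) => /eqP/eq_block_mx[CC AD _ _].
  rewrite -(@block_mx0 R n n n n) => /eqP/eq_block_mx[AA CB _ _].
  have {}CC : C^T = C by apply/eqP; rewrite -subr_eq0 CC.
  have {}AA : A^T = - A by apply/eqP; rewrite -addr_eq0 AA.
  have {}CB : B = - C by apply/eqP; rewrite -addr_eq0 addrC -{1}CC CB.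
  have {}AD : D = A.
    by move/eqP: AD; rewrite -opprD oppr_eq0 AA addrC subr_eq0 => /eqP.
  exists (\matrix_(i, j) (A i j +i* C i j)).
    apply/matrixP=> i j; rewrite !mxE /=.
    move/matrixP: AA => /(_ i j); rewrite !mxE => ->.
    by move/matrixP: CC => /(_ i j); rewrite !mxE => ->.
  by rewrite CB AD /realify; congr block_mx; [|congr (- _)| |];
    apply/matrixP=> i j; rewrite !mxE.
rewrite /realify; set A := map_mx (@complex.Re R) Z.
set C := map_mx (@complex.Im R) Z.
have ZE i j : conjc (Z j i) = - Z i j.
  by move/matrixP: ZH => /(_ i j); rewrite !mxE.
have AA : A^T = - A.
  by apply/matrixP=> i j; have := ZE i j; rewrite !mxE;
    case: (Z i j) (Z j i) => [a b] [c d] /= [].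
have CC : C^T = C.
  by apply/matrixP=> i j; have := ZE i j; rewrite !mxE;
    case: (Z i j) (Z j i) => [a b] [c d] /= [_ /oppr_inj].
have CN : (- C)^T = - C by rewrite linearN /= CC.
rewrite !tr_block_mx !mulmx_block !add_block_mx AA CN CC.
rewrite !(mul0mx, mulmx0, mulNmx, mulmxN, mul1mx, mulmx1, addr0, add0r, opprK).
by rewrite !(addNr, subrr) block_mx0 eqxx.
Qed.

Lemma torusE (R : realType) (n : nat) (h : 'rV[R]_n) :
  torus h = block_mx 0 (- diag_mx h) (diag_mx h) 0.
Proof.
rewrite /torus /realify; congr block_mx; [|congr (- _)| |];
  by apply/matrixP=> i j; rewrite !mxE; case: (i == j); rewrite ?mulr1n ?mulr0n.
Qed.

Lemma torus_linear (R : realType) (n : nat) : linear (@torus R n).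
Proof.
move=> a u v; rewrite !torusE scale_block_mx add_block_mx linearP /= !scaler0.
by rewrite !addr0 opprD scalerN.
Qed.

Lemma talgP (R : realType) (n : nat) (X : 'M[R]_(n + n)) :
  X \in talg R n <-> exists h : 'rV[R]_n, X = torus h.
Proof.
split=> [/memv_imgP[h _ ->]|[h ->]].
  by exists h; rewrite linfun_linear //; exact: torus_linear.
by rewrite -(linfun_linear h (@torus_linear R n)) memv_img ?memvf.
Qed.

Lemma estarE (R : realType) (n : nat) (j : 'I_n) (h : 'rV[R]_n) :
  estar R j (vsproj (talg R n) (torus h)) = h 0 j.
Proof.
rewrite linfun_linear => [|a u v]; last by rewrite !linearP /= !mxE.
rewrite vsprojK; last by apply/talgP; exists h.
by rewrite torusE block_mxKdl mxE eqxx mulr1n.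
Qed.

Lemma restrictE (R : realType) (m : nat) (V W : {vspace 'M[R]_m})
    (l : ldual W) (X : subvs_of V) :
  restrict V l X = l (vsproj W (vsval X)).
Proof. by rewrite linfun_linear // => a u v; rewrite !linearP. Qed.

Lemma lie_linear (R : realType) (m : nat) (X : 'M[R]_m) : linear (lie X).
Proof.
move=> a Y Z; rewrite /lie mulmxDl mulmxDr -scalemxAl -scalemxAr scalerBr.
by rewrite opprD addrACA.
Qed.

Lemma killing_linear (R : realType) (n : nat) (X : 'M[R]_(n + n)) :
  linear (killing X : _ -> R^o).
Proof.
move=> a Y Z; rewrite /killing scaler_sumr -big_split /=.
apply: eq_bigr => i _; rewrite -linearP -lie_linear; congr (coord _ _ (lie _ _)).
by rewrite /lie !(mulmxDl, mulmxDr, opprD, scalerBr) -scalemxAl -scalemxAr addrACA.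
Qed.

Lemma extendE (R : realType) (n : nat) (V W : {vspace 'M[R]_(n + n)})
    (l : ldual V) (X : subvs_of W) :
  extend W l X = killing (sharp l) (vsval X).
Proof.
by rewrite linfun_linear // => a u v; rewrite linearP /= killing_linear.
Qed.

Lemma coadE (R : realType) (n : nat) (g : 'M[R]_(n + n)) (l : ldual (sp R n))
    (X : subvs_of (sp R n)) :
  coad g l X = l (vsproj (sp R n) (invmx g *m vsval X *m g)).
Proof.
rewrite linfun_linear // => a u v.
by rewrite [vsval _]linearP /= mulmxDr mulmxDl -scalemxAr -scalemxAl !linearP.
Qed.

(* Main.v *)
Require Import Defs.
From mathcomp Require Import all_boot all_order all_algebra.
From mathcomp Require Import boolp classical_sets reals.
From mathcomp Require Import ring lra.

Import Order.TTheory GRing.Theory Num.Theory.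
Local Open Scope classical_set_scope.
Local Open Scope ring_scope.

(** On [sp R n] the Killing form is [(2n + 2) tr (X Y)], so [xi] lies in the
    moment polytope iff the skew-symmetric part of [g T g^-1] is the torus
    element of [xi] for some symplectic [g], where [T] is the torus element of
    [Lambda].  Writing [J] for the symplectic matrix, [D x] for
    [diag (x, x)] and [h = g^-1], one has [g T g^-1 = J S] with
    [S = h^T (D Lambda) h], and the condition reads
    [S - J S J = 2 (D xi)]: the form [S] has symplectic eigenvalues [Lambda],
    and its compression to an eigenspace of [iJ] is [diag xi].  A min-max
    argument then gives [Lambda_k <= xi_k].  Conversely, a diagonal [g] with
    entries [t_i, 1 / t_i] such that [t_i^2 + t_i^-2 = 2 xi_i / Lambda_i]
    realizes every [xi] with [Lambda_i <= xi_i]. *)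

(** * The symplectic matrix and its Lie algebra *)

Lemma sympJK (R : realType) (n : nat) : sympJ R n *m sympJ R n = - 1%:M.
Proof.
rewrite /sympJ mulmx_block !(mul0mx, mulmx0, mulNmx, mulmxN, mul1mx, mulmx1).
by rewrite !(addr0, add0r) scalar_mx_block opp_block_mx !oppr0.
Qed.

Lemma tr_sympJ (R : realType) (n : nat) : (sympJ R n)^T = - sympJ R n.
Proof.
by rewrite /sympJ tr_block_mx opp_block_mx !linearN /= !trmx0 trmx1 opprK
  !oppr0.
Qed.

Lemma sympJKr (R : realType) (n m : nat) (A : 'M_(m, n + n)) :
  A *m sympJ R n *m sympJ R n = - A.
Proof. by rewrite -mulmxA sympJK mulmxN mulmx1. Qed.

(** Multiplying the defining equation by [J] presents [sp R n] as the fixed space of the involution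
    [Z |-> J Z^T J]; averaging over it yields a projection onto [sp R n]. *)
Lemma mem_spE (R : realType) (n : nat) (X : 'M[R]_(n + n)) :
  (X \in sp R n) = (sympJ R n *m X^T *m sympJ R n == X).
Proof.
rewrite mem_sp; apply/eqP/eqP => [XJ|XJ].
  have /eqP := congr1 (mulmx (sympJ R n)) XJ.
  rewrite mulmxDr !mulmxA sympJK mulmx0 mulNmx mul1mx subr_eq0.
  by move=> /eqP.
by rewrite -[in sympJ R n *m X]XJ !mulmxA sympJK !mulNmx mul1mx subrr.
Qed.

(** * The Killing form as a trace form *)

(** An endomorphism with image in [V] has the same trace on [V] as on all matrices: expand each
    [F (delta_mx j k)] in the basis of [V], each basis vector in matrix units, and exchange the
    sums. *)
Lemma trace_image (R : fieldType) (m : nat) (V : {vspace 'M[R]_m})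
    (F : 'End('M[R]_m)) : (forall Z, F Z \in V) ->
  \sum_(i < \dim V) coord (vbasis V) i (F (vbasis V)`_i)
    = \sum_j \sum_k F (delta_mx j k) j k.
Proof.
move=> FV.
under [RHS]eq_bigr => j _ do under eq_bigr => k _ do
  rewrite [F _](coord_vbasis (FV _)) summxE.
under [RHS]eq_bigr => j _ do rewrite exchange_big.
rewrite exchange_big /=; apply: eq_bigr => i _.
rewrite [(_)`_i in LHS]matrix_sum_delta linear_sum linear_sum.
apply: eq_bigr => j _; rewrite linear_sum linear_sum; apply: eq_bigr => k _.
by rewrite linearZ linearZ /= [in RHS]mxE mulrC.
Qed.

(** This is the trace of [Z |-> A Z B]; its diagonal coefficient at [(j, k)] is [A j j * B k k]. *)
Lemma trace_mul (R : comNzRingType) (m : nat) (A B : 'M[R]_m) :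
  \sum_j \sum_k (A *m delta_mx j k *m B) j k = \tr A * \tr B.
Proof.
rewrite /mxtrace big_distrl; apply: eq_bigr => j _; rewrite big_distrr.
apply: eq_bigr => k _ /=; rewrite mxE (bigD1 k) //= big1 ?addr0; last first.
  move=> l lk; rewrite mxE big1 ?mul0r // => p _.
  by rewrite mxE (negPf lk) andbF mulr0.
rewrite mxE (bigD1 j) //= big1 ?addr0; last first.
  by move=> l lk; rewrite mxE (negPf lk) mulr0.
by rewrite mxE !eqxx mulr1.
Qed.

(** This is the trace of [Z |-> A Z^T B]; its diagonal coefficient at [(j, k)] is
    [A j k * B j k]. *)
Lemma trace_mul_tr (R : comNzRingType) (m : nat) (A B : 'M[R]_m) :
  \sum_j \sum_k (A *m (delta_mx j k)^T *m B) j k = \tr (A *m B^T).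
Proof.
rewrite /mxtrace; apply: eq_bigr => j _; rewrite mxE.
apply: eq_bigr => k _; rewrite !mxE (bigD1 j) //= big1 ?addr0; last first.
  move=> l lk; rewrite mxE big1 ?mul0r // => p _.
  by rewrite !mxE (negPf lk) mulr0.
rewrite mxE (bigD1 k) //= big1 ?addr0; last first.
  by move=> l lk; rewrite !mxE (negPf lk) andbF mulr0.
by rewrite !mxE !eqxx mulr1.
Qed.

Lemma lie_sp (R : realType) (n : nat) (X Y : 'M[R]_(n + n)) :
  X \in sp R n -> Y \in sp R n -> lie X Y \in sp R n.
Proof.
rewrite !mem_sp !addr_eq0 => /eqP XJ /eqP YJ.
rewrite /lie linearB /= !trmx_mul mulmxBl -!mulmxA XJ YJ !mulmxN !mulmxA XJ YJ.
by rewrite !mulNmx !opprK mulmxBr !mulmxA opprB.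
Qed.

Lemma tr_sp (R : realType) (n : nat) (X : 'M[R]_(n + n)) :
  X \in sp R n -> \tr X = 0.
Proof.
rewrite mem_spE => /eqP XJ.
have : \tr X = - \tr X.
  by rewrite -[in LHS]XJ mxtrace_mulC mulmxA sympJK mulNmx mul1mx raddfN /=
    mxtrace_tr.
lra.
Qed.

(* [Z |-> (Z + J Z^T J) / 2] projects all matrices onto [sp R n], so the trace
   of [ad X \o ad Y] may be computed on matrix units after composing with it. *)
Lemma killingE (R : realType) (n : nat) (X Y : 'M[R]_(n + n)) :
  X \in sp R n -> Y \in sp R n -> killing X Y = (n + n).+2%:R * \tr (X *m Y).
Proof.
move=> Xsp Ysp.
pose J := sympJ R n.
pose f (Z : 'M[R]_(n + n)) := lie X (lie Y (2^-1 *: (Z + J *m Z^T *m J))).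
have flin : linear f.
  move=> a U V; rewrite /f -!lie_linear; congr (lie _ (lie _ _)).
  rewrite linearP /= mulmxDr mulmxDl -scalemxAr -scalemxAl !scalerDr !scalerA.
  by rewrite addrACA (mulrC a).
pose F := linfun f.
have FfE Z : F Z = f Z by rewrite /F linfun_linear.
have FV Z : F Z \in sp R n.
  rewrite FfE; do 2 apply: lie_sp => //; rewrite memvZ // mem_sp -/J.
  rewrite linearD /= !trmx_mul trmxK !tr_sympJ !(mulmxN, mulNmx) opprK.
  rewrite mulmxDl mulmxDr !mulmxA sympJKr sympJK !mulNmx mul1mx.
  by rewrite addrA subrK subrr.
have -> : killing X Y = \sum_(i < \dim (sp R n))
    coord (vbasis (sp R n)) i (F (vbasis (sp R n))`_i).
  rewrite /killing; apply: eq_bigr => i _; rewrite FfE.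
  congr (coord _ _ (lie X (lie Y _))).
  have : (vbasis (sp R n))`_i \in sp R n.
    by apply: vbasis_mem; rewrite mem_nth // size_tuple.
  rewrite mem_spE => /eqP ->; rewrite -mulr2n -scaler_nat scalerA.
  by rewrite mulVf ?scale1r // pnatr_eq0.
rewrite trace_image //.
(* The expansion is arranged so that each of the eight terms has the shape [A Z B] or [A Z^T B]. *)
have FE Z : F Z = 2^-1 *: (
    (X *m Y *m Z *m 1%:M + 1%:M *m Z *m (Y *m X)
    - X *m Z *m Y - Y *m Z *m X) +
    ((X *m Y *m J) *m Z^T *m J + J *m Z^T *m (J *m Y *m X)
     - (X *m J) *m Z^T *m (J *m Y) - (Y *m J) *m Z^T *m (J *m X))).
  rewrite FfE /f /lie -!(scalemxAl, scalemxAr, scalerBr); congr (_ *: _).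
  rewrite mul1mx mulmx1 !(mulmxDl, mulmxDr, mulmxBl, mulmxBr, mulmxN, mulNmx).
  rewrite !mulmxA !opprD !opprK.
  set a := X *m Y *m Z; set b := X *m Z *m Y; set c := Y *m Z *m X.
  set d := Z *m Y *m X.
  set a' := X *m Y *m J *m _ *m _; set b' := X *m J *m _ *m _ *m _.
  set c' := Y *m J *m _ *m _ *m _; set d' := J *m _ *m _ *m _ *m _.
  by apply/matrixP => i j; rewrite !mxE; ring.
have HD (A B : 'M[R]_(n + n)) j k : (A + B) j k = A j k + B j k by rewrite mxE.
have HN (A : 'M[R]_(n + n)) j k : (- A) j k = - A j k by rewrite mxE.
have HZ a (A : 'M[R]_(n + n)) j k : (a *: A) j k = a * A j k by rewrite mxE.
under eq_bigr => j _.
  under eq_bigr => k _ do rewrite FE !(HZ, HD, HN).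
  rewrite -mulr_sumr !(big_split, sumrN) /=; over.
(* Among the terms in [Z], two give [(n + n) tr (X Y)] and two vanish because [sp R n] is traceless;
   each of the four terms in [Z^T] gives [tr (X Y)]. Half the total is [(2n + 2) tr (X Y)]. *)
rewrite -mulr_sumr !(big_split, sumrN) /= !trace_mul !trace_mul_tr.
rewrite !trmx_mul !mxtrace1 !tr_sympJ -/J !mulmxN !mulmxA !sympJKr.
rewrite !(mulNmx, mulmxN, opprK) !(raddfN, opprK) /=.
have JX : J *m X^T *m J = X by apply/eqP; rewrite -mem_spE.
have JY : J *m Y^T *m J = Y by apply/eqP; rewrite -mem_spE.
rewrite (tr_sp _ _ _ Xsp) (tr_sp _ _ _ Ysp).
rewrite (mxtrace_mulC (J *m X^T *m Y^T)) !mulmxA sympJK mulNmx mul1mx.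
rewrite -[X in - X *m Y^T]mulmx1 mulNmx raddfN /= mulmx1.
rewrite -trmx_mul mxtrace_tr opprK.
rewrite -(mulmxA X J) -(mulmxA X) JY -(mulmxA Y J) -(mulmxA Y) JX.
rewrite (mxtrace_mulC Y X) -[in RHS]addn2 natrD.
by field.
Qed.

(** * Torus elements, their duals and the holomorphic chamber *)

(** The Gram matrix of the quadratic form [sum_i h_i (q_i^2 + p_i^2)]; multiplication by [J] turns
    it into the torus element of [h]. *)
Definition diag2 (R : realType) (n : nat) (h : 'rV[R]_n) : 'M[R]_(n + n) :=
  block_mx (diag_mx h) 0 0 (diag_mx h).

Lemma torus_diag2 (R : realType) (n : nat) (h : 'rV[R]_n) :
  torus h = sympJ R n *m diag2 R n h.
Proof.
rewrite torusE /sympJ /diag2 mulmx_block.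
by rewrite !(mul0mx, mulmx0, mulNmx, mul1mx, addr0, add0r).
Qed.

Lemma tr_diag2 (R : realType) (n : nat) (h : 'rV[R]_n) :
  (diag2 R n h)^T = diag2 R n h.
Proof. by rewrite /diag2 tr_block_mx !tr_diag_mx !trmx0. Qed.

Lemma diag2_sympJ (R : realType) (n : nat) (h : 'rV[R]_n) :
  diag2 R n h *m sympJ R n = sympJ R n *m diag2 R n h.
Proof.
rewrite /sympJ /diag2 !mulmx_block.
by rewrite !(mul0mx, mulmx0, mulNmx, mulmxN, mulmx1, mul1mx, addr0, add0r).
Qed.

Lemma torus_sp (R : realType) (n : nat) (h : 'rV[R]_n) : torus h \in sp R n.
Proof.
rewrite mem_spE torus_diag2 trmx_mul tr_diag2 tr_sympJ !mulmxN diag2_sympJ.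
by rewrite mulNmx !mulmxA sympJK !mulNmx mul1mx opprK diag2_sympJ.
Qed.

Lemma trace_torus (R : realType) (n : nat) (h k : 'rV[R]_n) :
  \tr (torus h *m torus k) = - (2 * \sum_i h 0 i * k 0 i).
Proof.
rewrite !torusE mulmx_block !(mul0mx, mulmx0, addr0, add0r, mulNmx, mulmxN).
rewrite mxtrace_block !raddfN /= !mulmx_diag !mxtrace_diag -opprD -mulr2n.
rewrite mulr_natl.
by congr (- (_ *+ 2)); apply: eq_bigr => i _; rewrite mxE.
Qed.

Lemma killing_torus (R : realType) (n : nat) (h k : 'rV[R]_n) :
  killing (torus h) (torus k)
    = - ((n + n).+2%:R * 2 * \sum_i h 0 i * k 0 i).
Proof. by rewrite killingE ?torus_sp // trace_torus mulrN mulrA. Qed.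

Lemma tformE (R : realType) (n : nat) (xi h : 'rV[R]_n) :
  tform xi (vsproj (talg R n) (torus h)) = \sum_i xi 0 i * h 0 i.
Proof.
rewrite /tform sum_lfunE; apply: eq_bigr => i _.
by rewrite scale_lfunE estarE.
Qed.

(** In the coordinates of the torus the Killing form is minus the inverse of this constant times the
    standard inner product. *)
Definition sharp_coef (R : realType) (n : nat) : R :=
  ((n + n).+2%:R * 2)^-1.

Lemma sharp_coef_gt0 (R : realType) (n : nat) : 0 < sharp_coef R n.
Proof. by rewrite invr_gt0 mulr_gt0 ?ltr0n. Qed.

Lemma sharp_tform (R : realType) (n : nat) (xi : 'rV[R]_n) :
  sharp (tform xi) = torus (- sharp_coef R n *: xi).
Proof.
have := pnatr_eq0 R (n + n).+2; set m := (n + n).+2%:R => /negbT c0.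
have torus_talg h : torus h \in talg R n by apply/talgP; exists h.
(* The default value of [xget] is excluded by exhibiting a representative; any representative is
   then determined by testing it on the torus elements of the unit vectors. *)
rewrite /sharp; case: xgetP => [H _ HP|/(_ (vsproj _ (torus _)))]; last first.
  move=> /(_ (- sharp_coef R n *: xi)) [] X /=.
  have /talgP[h Xh] := valP X.
  rewrite -[X in tform xi X]vsvalK Xh tformE vsprojK // killing_torus.
  rewrite -mulrN -sumrN mulr_sumr; apply: eq_bigr => i _.
  rewrite mxE /sharp_coef.
  by rewrite -/m; clearbody m; field.
have /talgP[h Hh] := valP H; rewrite Hh; congr torus.
apply/rowP => j; have := HP (vsproj _ (torus (delta_mx 0 j))).
rewrite vsprojK // Hh killing_torus tformE (bigD1 j) //=.
rewrite big1 => [|i ij]; last first.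
  by rewrite mxE (negPf ij) andbF mulr0.
rewrite [X in _ = X](bigD1 j) //= [X in _ = _ + X]big1 => [|i ij]; last first.
  by rewrite mxE (negPf ij) andbF mulr0.
rewrite !mxE !eqxx !mulr1 !addr0 => <-; rewrite /sharp_coef.
by rewrite -/m; clearbody m; field.
Qed.

Lemma tdotE (R : realType) (n : nat) (xi eta : 'rV[R]_n) :
  tdot xi eta = sharp_coef R n * \sum_i xi 0 i * eta 0 i.
Proof.
have := pnatr_eq0 R (n + n).+2; set m := (n + n).+2%:R => /negbT c0.
rewrite /tdot !sharp_tform killing_torus opprK !mulr_sumr.
by apply: eq_bigr => i _; rewrite !mxE /sharp_coef -/m; clearbody m; field.
Qed.

(** The long root [2 e_i^*], the case [i = j] of the noncompact roots, pairs with [xi] to a positive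
    multiple of the [i]-th coordinate. *)
Lemma hol_chamber_gt0 (R : realType) (n : nat) (xi : 'rV[R]_n) (i : 'I_n) :
  hol_chamber xi -> 0 < xi 0 i.
Proof.
move=> [_ /(_ (delta_mx 0 i + delta_mx 0 i))].
have -> : tdot (delta_mx 0 i + delta_mx 0 i) xi = sharp_coef R n * 2 * xi 0 i.
  rewrite tdotE -mulrA; congr (_ * _); rewrite (bigD1 i) //= big1 => [|j ji].
    by rewrite !mxE !eqxx addr0.
  by rewrite !mxE (negPf ji) andbF addr0 mul0r.
rewrite pmulr_rgt0; first by apply; exists i, i.
by rewrite mulr_gt0 ?sharp_coef_gt0 ?ltr0n.
Qed.

(** * The symplectic group and the moment map condition *)

Lemma Sp_unitmx (R : realType) (n : nat) (g : 'M[R]_(n + n)) :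
  @Sp R n g -> g \in unitmx.
Proof.
move=> gS; have gK : - (sympJ R n *m g^T *m sympJ R n) *m g = 1%:M.
  by rewrite mulNmx -!mulmxA (mulmxA g^T) gS sympJK opprK.
by have [] := mulmx1_unit gK.
Qed.

Lemma Sp_sympJV (R : realType) (n : nat) (g : 'M[R]_(n + n)) :
  @Sp R n g -> sympJ R n *m invmx g = g^T *m sympJ R n.
Proof. by move=> gS; rewrite -[in LHS]gS mulmxK ?Sp_unitmx. Qed.

Lemma Sp_trV_sympJ (R : realType) (n : nat) (g : 'M[R]_(n + n)) :
  @Sp R n g -> (invmx g)^T *m sympJ R n = sympJ R n *m g.
Proof.
move=> /Sp_sympJV/(congr1 trmx); rewrite !trmx_mul trmxK tr_sympJ mulmxN mulNmx.
exact: oppr_inj.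
Qed.

Lemma Sp_conj_sp (R : realType) (n : nat) (g X : 'M[R]_(n + n)) :
  @Sp R n g -> X \in sp R n -> invmx g *m X *m g \in sp R n.
Proof.
move=> gS; rewrite !mem_sp addr_eq0 => /eqP XJ.
rewrite !mulmxA (Sp_sympJV _ _ _ gS) !trmx_mul -!mulmxA (Sp_trV_sympJ _ _ _ gS).
by rewrite (mulmxA X^T) XJ !mulNmx mulmxN !mulmxA addNr.
Qed.

Lemma SpV (R : realType) (n : nat) (g : 'M[R]_(n + n)) :
  @Sp R n g -> @Sp R n (invmx g).
Proof.
move=> gS; have gu := Sp_unitmx _ _ _ gS.
by rewrite /Sp /= (Sp_trV_sympJ _ _ _ gS) mulmxK.
Qed.

Lemma skew_part_kalg (R : realType) (n : nat) (X : 'M[R]_(n + n)) :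
  X \in sp R n -> X - X^T \in kalg R n.
Proof.
rewrite mem_kalg linearB /= trmxK addrA subrK subrr eqxx andbT => Xsp.
rewrite rpredB // mem_spE trmxK; move: Xsp; rewrite mem_spE => /eqP XJ.
apply/eqP; rewrite -[in RHS]XJ !trmx_mul trmxK tr_sympJ.
by rewrite !mulmxN !mulNmx opprK mulmxA.
Qed.

(** This is the Cartan decomposition: for the trace form, the orthogonal of the skew part [kalg R n]
    in [sp R n] is the symmetric part. Testing [X] on [D = X - X^T] gives [tr (D D^T) = 0], a
    vanishing sum of squares. *)
Lemma trace_kalg_eq0 (R : realType) (n : nat) (X : 'M[R]_(n + n)) :
  X \in sp R n ->
  (forall Y, Y \in kalg R n -> \tr (X *m Y) = 0) <-> X^T = X.
Proof.
move=> Xsp; split=> [XY|XT Y]; last first.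
  rewrite mem_kalg => /andP[_]; rewrite addr_eq0 => /eqP YT.
  have : \tr (X *m Y) = - \tr (X *m Y).
    by rewrite -[LHS]mxtrace_tr trmx_mul YT XT mulNmx raddfN /= mxtrace_mulC.
  lra.
have XK := skew_part_kalg _ _ _ Xsp; have XY0 := XY _ XK.
pose D := X - X^T; have DT : D^T = - D.
  by rewrite /D linearB /= trmxK opprB.
have : \tr (D *m D^T) = 0.
  rewrite DT mulmxN raddfN /= {1}/D mulmxBl raddfB /= XY0.
  rewrite -mxtrace_tr trmx_mul DT trmxK mulNmx raddfN /= mxtrace_mulC XY0.
  by rewrite oppr0 subr0 oppr0.
have -> : \tr (D *m D^T) = \sum_i \sum_j D i j ^+ 2.
  by apply: eq_bigr => i _; rewrite mxE; apply: eq_bigr => j _;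
    rewrite [X in _ * X]mxE expr2.
have sq_ge0 i : 0 <= \sum_j D i j ^+ 2.
  by apply: sumr_ge0 => j _; exact: sqr_ge0.
move=> /eqP; rewrite psumr_eq0 // => /allP D0.
apply/esym/eqP; rewrite -subr_eq0; apply/eqP/matrixP => i j; rewrite [RHS]mxE.
have := D0 i (mem_index_enum _); rewrite /= psumr_eq0; last first.
  by move=> ? _; exact: sqr_ge0.
by move=> /allP/(_ j (mem_index_enum _)) /=; rewrite sqrf_eq0 => /eqP.
Qed.

(** Both forms on [kalg R n] are trace pairings, and their difference is a multiple of the pairing
    with [N]; they agree iff [N] is orthogonal to [kalg R n]. *)
Lemma PhiK_coadjoint (R : realType) (n : nat) (Lambda xi : 'rV[R]_n)
    (g : 'M[R]_(n + n)) : @Sp R n g ->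
  let N := g *m torus Lambda *m invmx g - torus xi in
  PhiK (coad g (extend (sp R n) (tform Lambda))) = extend (kalg R n) (tform xi)
    <-> N^T = N.
Proof.
move=> gS N; have gu := Sp_unitmx _ _ _ gS.
have Nsp : N \in sp R n.
  rewrite rpredB ?torus_sp //.
  by rewrite -[X in X *m _ *m _]invmxK Sp_conj_sp ?torus_sp //; exact: SpV.
have sp_kalg Y : Y \in kalg R n -> Y \in sp R n by rewrite mem_kalg => /andP[].
have torusZ h : torus (- sharp_coef R n *: h) = - sharp_coef R n *: torus h.
  by rewrite !torusE scale_block_mx !linearZ /= !scaler0.
(* The factor is the Killing constant [2n + 2] times [- sharp_coef R n]; cyclicity of the trace
   moves the conjugation from [Y] to the torus element. *)
have diffE (Y : subvs_of (kalg R n)) :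
    PhiK (coad g (extend (sp R n) (tform Lambda))) Y
      - extend (kalg R n) (tform xi) Y = - 2^-1 * \tr (N *m vsval Y).
  have Ysp := sp_kalg _ (valP Y).
  rewrite /PhiK restrictE coadE !extendE !vsprojK ?Sp_conj_sp //.
  rewrite !killingE ?Sp_conj_sp ?sharp_tform ?torus_sp // !torusZ.
  rewrite -!scalemxAl !mxtraceZ /N mulmxBl raddfB /=.
  rewrite (_ : \tr (torus Lambda *m _) =
      \tr (g *m torus Lambda *m invmx g *m vsval Y)); last first.
    by rewrite !mulmxA mxtrace_mulC !mulmxA.
  have := pnatr_eq0 R (n + n).+2; rewrite /sharp_coef; set m := (n + n).+2%:R.
  by move=> /negbT m0; clearbody m; field.
rewrite -(trace_kalg_eq0 _ _ _ Nsp); split=> [PhiE Y YK|N0].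
  have := diffE (vsproj _ Y); rewrite PhiE subrr vsprojK // => /esym/eqP.
  by rewrite mulf_eq0 oppr_eq0 invr_eq0 pnatr_eq0 => /eqP.
apply/lfunP => Y; apply/eqP; rewrite -subr_eq0 diffE N0 ?mulr0 //.
exact: valP.
Qed.

(** * Necessity of the inequalities, by min-max *)

Lemma row_mul_trE (R : comNzRingType) (m : nat) (u w : 'rV[R]_m) :
  (u *m w^T) 0 0 = \sum_i u 0 i * w 0 i.
Proof. by rewrite mxE; apply: eq_bigr => i _; rewrite mxE. Qed.

Lemma diag2_form (R : realType) (n : nat) (h : 'rV[R]_n) (y : 'rV[R]_(n + n)) :
  (y *m diag2 R n h *m y^T) 0 0
    = \sum_i h 0 i * (y 0 (lshift n i) ^+ 2 + y 0 (rshift n i) ^+ 2).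
Proof.
rewrite row_mul_trE big_split_ord /= -big_split /=; apply: eq_bigr => i _.
rewrite /diag2 -[y in y *m _]hsubmxK mul_row_block !mulmx0 addr0 add0r.
by rewrite row_mxEl row_mxEr !mul_mx_diag !mxE; ring.
Qed.

Lemma sympJ_form (R : realType) (n : nat) (y z : 'rV[R]_(n + n)) :
  (y *m sympJ R n *m z^T) 0 0
    = \sum_i (y 0 (rshift n i) * z 0 (lshift n i)
              - y 0 (lshift n i) * z 0 (rshift n i)).
Proof.
rewrite row_mul_trE big_split_ord /= -big_split /=; apply: eq_bigr => i _.
rewrite /sympJ -[y in y *m _]hsubmxK mul_row_block !mulmx0 add0r addr0.
by rewrite mulmxN !mulmx1 row_mxEl row_mxEr !mxE mulNr.
Qed.

Lemma row_sympJE (R : realType) (n : nat) (y : 'rV[R]_(n + n)) (i : 'I_n) :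
  (y *m sympJ R n) 0 (lshift n i) = y 0 (rshift n i) /\
  (y *m sympJ R n) 0 (rshift n i) = - y 0 (lshift n i).
Proof.
rewrite /sympJ -[y in y *m _]hsubmxK mul_row_block !mulmx0 add0r addr0.
by rewrite mulmxN !mulmx1 row_mxEl row_mxEr !mxE.
Qed.

Lemma exists_constrained_vector (R : fieldType) (n : nat) (k : 'I_n)
    (G : 'M[R]_(n + n)) :
  exists2 v : 'rV[R]_(n + n), v != 0 &
    forall i : 'I_n,
      ((i < k)%N -> v 0 (lshift n i) = 0 /\ v 0 (rshift n i) = 0) /\
      ((k < i)%N -> (v *m G) 0 (lshift n i) = 0 /\ (v *m G) 0 (rshift n i) = 0).
Proof.
(* These are [2n - 2] linear conditions on [2n] unknowns: in the square system
   [v *m A = 0] the two columns indexed by [k] vanish. *)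
pose ix (j : 'I_(n + n)) := match split j with inl i => i | inr i => i end.
have ixl i : ix (lshift n i) = i by rewrite /ix (unsplitK (inl i)).
have ixr i : ix (rshift n i) = i by rewrite /ix (unsplitK (inr i)).
pose A := \matrix_(i, j) (if (ix j < k)%N then (i == j)%:R
                          else if (k < ix j)%N then G i j else 0)
  : 'M[R]_(n + n).
have : \det A = 0.
  rewrite (expand_det_col _ (lshift n k)) big1 // => i _.
  by rewrite mxE ixl ltnn mul0r.
move=> /eqP/det0P[v v0 vA]; exists v => // i.
have low j : (ix j < k)%N -> v 0 j = 0.
  move=> jk; have := congr1 (fun M : 'rV_(n + n) => M 0 j) vA.
  rewrite /= !mxE (bigD1 j) //= big1 => [|l lj].
    by rewrite mxE jk eqxx mulr1 addr0.
  by rewrite mxE jk (negPf lj) mulr0.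
have high j : (k < ix j)%N -> (v *m G) 0 j = 0.
  move=> kj; have := congr1 (fun M : 'rV_(n + n) => M 0 j) vA.
  rewrite /= !mxE => {2}<-; apply: eq_bigr => l _.
  by rewrite mxE kj ltnNge ltnW.
by split=> ik; split; (apply: low || apply: high); rewrite ?ixl ?ixr.
Qed.

(** For a suitable nonzero [v], the value [v (D xi) v^T] is at most [xi_k |v|^2] and at least
    [Lambda_k |v|^2]. *)
Lemma symplectic_eigenvalue_le (R : realType) (n : nat) (Lambda xi : 'rV[R]_n)
    (g : 'M[R]_(n + n)) :
  weyl_chamber Lambda -> (forall i, 0 < Lambda 0 i) -> weyl_chamber xi ->
  @Sp R n g ->
  let N := g *m torus Lambda *m invmx g - torus xi in N^T = N ->
  forall k, Lambda 0 k <= xi 0 k.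
Proof.
move=> LW L0 xiW gS N NT k.
pose J := sympJ R n; pose h := invmx g; pose D := diag2 R n xi.
pose S := h^T *m diag2 R n Lambda *m h.
have hS : h^T *m J *m h = J := SpV _ _ _ gS.
have ST : S^T = S by rewrite /S !trmx_mul trmxK tr_diag2 mulmxA.
have NE : N = J *m S - J *m D.
  rewrite /N !torus_diag2 -/h -/J -/D; congr (_ - _); rewrite /S !mulmxA.
  (* Multiplying [h^T J = J g] by [J] on both sides gives [J h^T = g J]. *)
  congr (_ *m _ *m _); have := congr1 (mulmx J) (Sp_trV_sympJ _ _ _ gS).
  rewrite -/h -/J mulmxA => /(congr1 (mulmx^~ J)) /=.
  rewrite !mulmxA sympJK sympJKr !mulNmx mul1mx => /oppr_inj.
  by move=> ->.
(* Symmetry of [N] reads [J S + S J = 2 J D]; multiply by [J]. *)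
have SD : S - J *m S *m J = D + D.
  move: NT; rewrite NE linearB /= (trmx_mul J S) (trmx_mul J D) ST.
  rewrite tr_diag2 !tr_sympJ -/J !mulmxN.
  rewrite diag2_sympJ -/D -/J opprK => /(congr1 (mulmx J)).
  rewrite !(mulmxBr, mulmxDr, mulmxN) !mulmxA sympJK !mulNmx !mul1mx opprK => E.
  apply/matrixP => i j; have /matrixP/(_ i j) := E; rewrite !mxE.
  lra.
(* [v] is the real part of the vector [v + i v J], which lies in an eigenspace
   of [iJ]; for [i > k] the constraint kills the component of its image under
   [h] in the [i]-th line of that eigenspace. *)
have [v v0 vP] := exists_constrained_vector _ _ k (h^T - J *m h^T *m J).
pose y1 := v *m h^T; pose y2 := v *m J *m h^T.
have normE : (v *m v^T) 0 0 =
    \sum_i (v 0 (lshift n i) ^+ 2 + v 0 (rshift n i) ^+ 2).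
  by rewrite row_mul_trE big_split_ord /= -big_split.
have form1 : (y1 *m diag2 R n Lambda *m y1^T) 0 0
    + (y2 *m diag2 R n Lambda *m y2^T) 0 0 = 2 * (v *m D *m v^T) 0 0.
  have -> : y1 *m diag2 R n Lambda *m y1^T = v *m S *m v^T.
    by rewrite /y1 /S trmx_mul trmxK !mulmxA.
  have -> : y2 *m diag2 R n Lambda *m y2^T = - (v *m (J *m S *m J) *m v^T).
    by rewrite /y2 /S !trmx_mul trmxK tr_sympJ !(mulmxA, mulNmx, mulmxN).
  have := congr1 (fun M => (v *m M *m v^T) 0 0) SD.
  rewrite /= mulmxBr mulmxBl mulmxDr mulmxDl !mxE => ->.
  by rewrite mulr_natl.
(* Since [h] preserves [J], the pairing of the images is that of [v] with [v J], namely [|v|^2]. *)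
have form2 : (y1 *m J *m y2^T) 0 0 = (v *m v^T) 0 0.
  rewrite /y1 /y2 !trmx_mul trmxK tr_sympJ !mulmxA.
  rewrite -(mulmxA v) -(mulmxA v) hS.
  by rewrite mulmxN mulNmx sympJKr mulNmx opprK.
move: form1 form2; rewrite !diag2_form sympJ_form normE => form1 form2.
have pos : 0 < \sum_i (v 0 (lshift n i) ^+ 2 + v 0 (rshift n i) ^+ 2).
  rewrite -normE row_mul_trE lt_def sumr_ge0 ?andbT => [|i _]; last first.
    by rewrite -expr2 sqr_ge0.
  apply: contra v0; rewrite psumr_eq0 => [/allP v0|i _]; last first.
    by rewrite -expr2 sqr_ge0.
  apply/eqP/rowP => i; have := v0 i (mem_index_enum _).
  by rewrite /= mulf_eq0 orbb mxE => /eqP.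
have up : \sum_i xi 0 i * (v 0 (lshift n i) ^+ 2 + v 0 (rshift n i) ^+ 2)
    <= xi 0 k * \sum_i (v 0 (lshift n i) ^+ 2 + v 0 (rshift n i) ^+ 2).
  rewrite mulr_sumr; apply: ler_sum => i _.
  have [low _] := vP i; case: (ltnP i k) => [/low[-> ->]|ki].
    by rewrite expr0n addr0 !mulr0.
  by rewrite ler_wpM2r ?addr_ge0 ?sqr_ge0 // xiW.
have lo : Lambda 0 k
      * (2 * \sum_i (v 0 (lshift n i) ^+ 2 + v 0 (rshift n i) ^+ 2))
    <= 2 * \sum_i xi 0 i * (v 0 (lshift n i) ^+ 2 + v 0 (rshift n i) ^+ 2).
  rewrite -form1 -form2 !mulr_sumr -big_split /=; apply: ler_sum => i _.
  have [_ high] := vP i.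
  have -> : Lambda 0 i * (y1 0 (lshift n i) ^+ 2 + y1 0 (rshift n i) ^+ 2)
    + Lambda 0 i * (y2 0 (lshift n i) ^+ 2 + y2 0 (rshift n i) ^+ 2)
    = Lambda 0 i * (y1 0 (lshift n i) ^+ 2 + y1 0 (rshift n i) ^+ 2 +
       (y2 0 (lshift n i) ^+ 2 + y2 0 (rshift n i) ^+ 2)) by ring.
  (* For [i > k] the constraint says that [y1 = y2 J] in the [i]-th plane, so the symplectic summand
     is minus a sum of squares. *)
  case: (ltnP k i) => [/high[]|ik].
    rewrite mulmxBr !mulmxA -/y1 -/y2.
    have subE (a b : 'rV[R]_(n + n)) j : (a - b) 0 j = a 0 j - b 0 j.
      by rewrite !mxE.
    have [Jl Jr] := row_sympJE _ _ y2 i; rewrite !subE Jl Jr.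
    move=> /eqP; rewrite subr_eq0 => /eqP ->.
    rewrite opprK addrC => /eqP; rewrite addr_eq0 => /eqP ->.
    apply: (@le_trans _ _ 0); last first.
      by rewrite mulr_ge0 ?(ltW (L0 _)) // !addr_ge0 ?sqr_ge0.
    rewrite mulr_ge0_le0 ?(ltW (L0 _)) //; nra.
  (* For [i <= k], twice the symplectic summand is at most the sum of the four squares, and
     [Lambda_k <= Lambda_i]. *)
  apply: (@le_trans _ _ (Lambda 0 k * (y1 0 (lshift n i) ^+ 2
     + y1 0 (rshift n i) ^+ 2 +
       (y2 0 (lshift n i) ^+ 2 + y2 0 (rshift n i) ^+ 2)))).
    rewrite ler_wpM2l ?(ltW (L0 _)) //.
    have := sqr_ge0 (y1 0 (rshift n i) - y2 0 (lshift n i)).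
    have := sqr_ge0 (y1 0 (lshift n i) + y2 0 (rshift n i)).
    rewrite sqrrB sqrrD; lra.
  by rewrite ler_wpM2r ?LW // !addr_ge0 ?sqr_ge0.
rewrite -(ler_pM2r pos); lra.
Qed.

(** * Sufficiency, by diagonal symplectic matrices *)

Lemma exists_half_sum_inv (R : realType) (r : R) :
  1 <= r -> exists2 t : R, t != 0 & t ^+ 2 + t ^- 2 = 2 * r.
Proof.
move=> r1; have d0 : 0 <= r ^+ 2 - 1 by nra.
(* The larger root of [s^2 - 2 r s + 1]; the roots are mutually inverse with sum [2 r], so
   [t = sqrt s] works. *)
pose s := r + Num.sqrt (r ^+ 2 - 1).
have s0 : 0 < s by rewrite ltr_pwDl ?sqrtr_ge0 //; lra.
exists (Num.sqrt s); first by rewrite gt_eqF ?sqrtr_gt0.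
rewrite sqr_sqrtr ?ltW //.
have sE : s ^+ 2 + 1 = 2 * r * s.
  by rewrite /s; have := sqr_sqrtr d0; nra.
by apply: (mulIf (lt0r_neq0 s0)); rewrite mulrDl mulVf ?lt0r_neq0.
Qed.

Lemma exists_symplectic_scaling (R : realType) (n : nat)
    (Lambda xi : 'rV[R]_n) :
  (forall i, 0 < Lambda 0 i) -> (forall i, Lambda 0 i <= xi 0 i) ->
  exists2 g : 'M[R]_(n + n), @Sp R n g &
    let N := g *m torus Lambda *m invmx g - torus xi in N^T = N.
Proof.
move=> L0 Lxi.
have /choice[t tP] (i : 'I_n) : exists t : R,
    t != 0 /\ t ^+ 2 + t ^- 2 = 2 * (xi 0 i / Lambda 0 i).
  have [|t t0 tE] := @exists_half_sum_inv _ (xi 0 i / Lambda 0 i).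
    2: by exists t.
  by rewrite ler_pdivlMr ?mul1r.
pose T : 'rV[R]_n := \row_i t i; pose T' : 'rV[R]_n := \row_i (t i)^-1.
have TT' : diag_mx T *m diag_mx T' = 1%:M.
  rewrite mulmx_diag -diag_const_mx; congr diag_mx; apply/rowP => i.
  by rewrite !mxE mulfV //; case: (tP i).
have T'T : diag_mx T' *m diag_mx T = 1%:M by rewrite (mulmx1C TT').
pose g : 'M[R]_(n + n) := block_mx (diag_mx T) 0 0 (diag_mx T').
pose g' : 'M[R]_(n + n) := block_mx (diag_mx T') 0 0 (diag_mx T).
have gg' : g *m g' = 1%:M.
  rewrite mulmx_block !(mul0mx, mulmx0, addr0, add0r) TT' T'T.
  by rewrite -scalar_mx_block.
have gV : invmx g = g'.
  have [gu _] := mulmx1_unit gg'.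
  by rewrite -[RHS]mul1mx -(mulVmx gu) -mulmxA gg' mulmx1.
exists g.
  rewrite /Sp /= /sympJ tr_block_mx !tr_diag_mx !trmx0 !mulmx_block.
  rewrite !(mul0mx, mulmx0, mulNmx, mulmxN, mulmx1, mul1mx, addr0, add0r).
  by rewrite TT' T'T.
rewrite gV /= !torusE !mulmx_block.
rewrite !(mul0mx, mulmx0, mulNmx, mulmxN, addr0, add0r).
rewrite opp_block_mx add_block_mx !oppr0 !addr0 opprK tr_block_mx !trmx0.
rewrite !mulmx_diag -!linearN -!linearD /= !tr_diag_mx.
(* The diagonal blocks of [N] vanish, so its symmetry amounts to equality of the two diagonal
   off-diagonal blocks, that is, to [(t_i^2 + t_i^-2) Lambda_i = 2 xi_i]. *)
have corner i : T' 0 i * Lambda 0 i * T' 0 i - xi 0 i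
    = - (T 0 i * Lambda 0 i * T 0 i) + xi 0 i.
  have [_ tE] := tP i.
  suff : T' 0 i * Lambda 0 i * T' 0 i + T 0 i * Lambda 0 i * T 0 i = 2 * xi 0 i.
    by lra.
  rewrite !mxE mulrAC -expr2 exprVn (mulrAC (t i)) -expr2 -mulrDl addrC tE.
  by rewrite -mulrA divfK ?lt0r_neq0.
by congr block_mx; congr diag_mx; apply/rowP => i; have := corner i;
  rewrite !mxE => ->.
Qed.

(** * The cone as an orthant, and the moment polytope *)

Theorem theorem7p4 (R : realType) (n : nat) (hn : (2 <= n)%N)
    (Lambda : 'rV[R]_n) (hLambda : hol_chamber Lambda) :
  DeltaK (coadjoint_orbit (extend (sp R n) (tform Lambda)))
    = [set Lambda + v | v in cone (@noncompact_roots R n)] `&` @weyl_chamber R n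
  /\
  [set Lambda + v | v in cone (@noncompact_roots R n)] `&` @weyl_chamber R n
    = [set xi | weyl_chamber xi /\ forall i : 'I_n, Lambda 0 i <= xi 0 i].
Proof.
have coneE : [set Lambda + v | v in cone (@noncompact_roots R n)]
    = [set xi | forall i : 'I_n, Lambda 0 i <= xi 0 i].
  apply/seteqP; split=> [_ [v [m [c [s [c0 sS ->]]]] <-] i|xi Lxi] /=.
    rewrite mxE lerDl summxE; apply: sumr_ge0 => j _; rewrite mxE mulr_ge0 //.
    by have [a [b [_ ->]]] := sS j; rewrite !mxE addr_ge0 ?ler0n.
  exists (xi - Lambda); last by rewrite addrC subrK.
  (* The long roots [2 e_i^*] alone span the orthant, whence the coefficients halved. *)
  exists n, (fun i => (xi 0 i - Lambda 0 i) / 2),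
    (fun i => delta_mx 0 i + delta_mx 0 i).
  split=> [i|i|]; first by rewrite divr_ge0 ?subr_ge0.
    by exists i, i.
  rewrite [LHS]row_sum_delta; apply: eq_bigr => i _.
  by rewrite -mulr2n -scaler_nat scalerA divfK ?pnatr_eq0 // !mxE.
have L0 i : 0 < Lambda 0 i := hol_chamber_gt0 _ _ _ i hLambda.
have DeltaE : DeltaK (coadjoint_orbit (extend (sp R n) (tform Lambda)))
    = [set xi | weyl_chamber xi /\ forall i : 'I_n, Lambda 0 i <= xi 0 i].
  apply/seteqP; split=> xi /= [].
    move=> [_ [g gS <-] /(PhiK_coadjoint _ _ _ _ _ gS) NT] xiW; split=> //.
    by apply: symplectic_eigenvalue_le gS NT => //; case: hLambda.
  move=> xiW Lxi; split=> //.
  have [g gS NT] := exists_symplectic_scaling _ _ _ _ L0 Lxi.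
  by exists (coad g (extend (sp R n) (tform Lambda)));
    [exists g | apply/PhiK_coadjoint].
by rewrite DeltaE coneE setIC.
Qed.
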